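(* Let $M_0$ be an $n\times n$ permutation matrix and let $M_r$ be the final configuration of a complete percolation sequence starting from $M_0$. Then there are pairwise disjoint square unitary tiles $T_1,\dots,T_m$ (for some $1\le m\le n$) such that the set of cells of $M_r$ containing $1$ is exactly $T_1\cup\cdots\cup T_m$ (so these tiles are separated by $0$'s), and every row and every column of $M_r$ meets exactly one of the tiles $T_j$.
   Context: Bootstrap percolation on a $0$-$1$ matrix: a cell is mutable if it contains $0$ and at least two of its (up to four) orthogonal neighbours (north, south, east, west) contain $1$. A percolation step changes one mutable cell from $0$ to $1$. A percolation sequence $M_0\to\cdots\to M_r$ is complete if $M_r$ has no mutable cell; $M_r$ is its final configuration. A tile of a matrix is a rectangular block of cells $\{c_{i,j}: i_0\le i\le i_0+k-1,\ j_0\le j\le j_0+l-1\}$; it is unitary if all its cells contain $1$, and square of size $k$ if $k=l$. *)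

(* Defs.v *)
From mathcomp Require Import all_boot all_fingroup all_algebra.

Set Implicit Arguments.
Unset Strict Implicit.
Unset Printing Implicit Defensive.

(* 0-1 matrices are matrices over bool, with false = 0 and true = 1.  The ring
   structure of bool (the field with two elements) only serves to make
   [is_perm_mx] available; percolation never adds entries. *)

Section Percolation.

Variables m n : nat.

Definition cell := ('I_m * 'I_n)%type.

Definition ones (M : 'M[bool]_(m, n)) : {set cell} :=
  [set c : cell | M c.1 c.2].

Definition neighbour (c d : cell) : bool :=
  ((c.1 == d.1) && ((c.2.+1 == d.2 :> nat) || (d.2.+1 == c.2 :> nat))) ||
  ((c.2 == d.2) && ((c.1.+1 == d.1 :> nat) || (d.1.+1 == c.1 :> nat))).

Definition mutable (M : 'M[bool]_(m, n)) (c : cell) : bool :=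
  (c \notin ones M) && (2 <= #|[set d in ones M | neighbour c d]|).

Definition fill (M : 'M[bool]_(m, n)) (c : cell) : 'M[bool]_(m, n) :=
  \matrix_(i, j) (if (i, j) == c then true else M i j).

Definition perc_step : rel 'M[bool]_(m, n) :=
  fun M M' => [exists c, mutable M c && (M' == fill M c)].

(* The sequence M_0 -> ... -> M_r is given by its head M_0 and its tail
   [:: M_1; ...; M_r], so that M_r is [last M0 Ms] and r may be 0. *)
Definition perc_sequence (M0 : 'M[bool]_(m, n)) (Ms : seq 'M[bool]_(m, n)) :=
  path perc_step M0 Ms.

Definition complete_perc_sequence M0 Ms : bool :=
  perc_sequence M0 Ms && [forall c, ~~ mutable (last M0 Ms) c].

Definition block (i0 j0 k l : nat) : {set cell} :=
  [set c : cell | (i0 <= c.1 < i0 + k) && (j0 <= c.2 < j0 + l)].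

(* Tiles are nonempty and lie inside the matrix, so k and l are the actual
   numbers of rows and columns of the tile. *)
Definition is_tile (k l : nat) (T : {set cell}) : Prop :=
  [/\ 0 < k, 0 < l &
      exists i0 j0, [/\ i0 + k <= m, j0 + l <= n & T = block i0 j0 k l]].

Definition square_tile (T : {set cell}) : Prop := exists k, is_tile k k T.

Definition unitary (M : 'M[bool]_(m, n)) (T : {set cell}) : bool :=
  T \subset ones M.

Definition meets_row (T : {set cell}) (i : 'I_m) : bool :=
  [exists j, (i, j) \in T].

Definition meets_col (T : {set cell}) (j : 'I_n) : bool :=
  [exists i, (i, j) \in T].

End Percolation.

(* Main.v *)
Require Import Defs.
From mathcomp Require Import all_boot all_fingroup all_algebra.
From mathcomp Require Import zify.

(** Count, in each row and each column, the maximal runs of ones.  Filling a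
    cell with at least two neighbours in [M] cannot increase the total number of
    runs, which is [2 * n] for a permutation matrix.  As every row and every
    column keeps a one, the final configuration has exactly one run per line.
    Stability forces two adjacent rows sharing a column to be equal, hence so
    are any two rows sharing a column, because columns are runs too.  The
    classes of equal rows are the tiles, and the permutation maps the rows of a
    tile bijectively onto its columns. *)

(** * Runs of ones in a single line *)

(** A maximal run is represented by its last element, so counting runs is taking a cardinal. The
    comparison with [j.+1] is made in [nat], so the last index needs no special case. *)
Definition run_ends {n : nat} (S : {set 'I_n}) : {set 'I_n} :=
  [set j in S | [forall k in S, k != j.+1 :> nat]].

Definition adjacent {n : nat} (j k : 'I_n) : bool :=
  (j.+1 == k :> nat) || (k.+1 == j :> nat).

Definition convex_ord {n : nat} (S : {set 'I_n}) : Prop :=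
  forall a b c : 'I_n, a \in S -> c \in S -> a <= b <= c -> b \in S.

Definition row_ones {m n : nat} (M : 'M[bool]_(m, n)) (i : 'I_m) : {set 'I_n} :=
  [set j | M i j].

Definition row_runs {m n : nat} (M : 'M[bool]_(m, n)) : nat :=
  \sum_i #|run_ends (row_ones M i)|.

(** The largest element of [S] below the gap [b] ends a run. As [b] is a plain number, [b = n]
    serves as a gap past the end of the line. *)
Lemma run_end_before n (S : {set 'I_n}) (a : 'I_n) (b : nat) :
  a \in S -> a < b -> (forall x, x \in S -> x != b :> nat) ->
  exists2 e, e \in run_ends S & a <= e < b.
Proof.
move=> aS ab Sb.
have Pa : (a \in S) && (a < b) by rewrite aS.
case: (@arg_maxnP _ a (fun x : 'I_n => (x \in S) && (x < b)) val Pa).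
move=> e /andP[eS eb] emax; exists e; last first.
  by rewrite eb andbT; apply: emax.
rewrite inE eS; apply/forall_inP => k kS; apply/eqP => ke.
have kb : k < b by have := Sb k kS; lia.
by have /= := emax k; rewrite kS kb => /(_ isT); lia.
Qed.

Lemma run_ends_gt0 n (S : {set 'I_n}) (a : 'I_n) : a \in S -> 0 < #|run_ends S|.
Proof.
move=> aS; have [|e eS _] := @run_end_before n S a n aS (ltn_ord a).
  by move=> x _; rewrite neq_ltn ltn_ord.
by apply/card_gt0P; exists e.
Qed.

(** A gap [b] between [a] and [c] would separate a run end in [[a, b)] from another in [[c, n)]. *)
Lemma run_ends_convex n (S : {set 'I_n}) : #|run_ends S| <= 1 -> convex_ord S.
Proof.
move=> S1 a b c aS cS abc; apply: contraT => bS.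
have neb x : x \in S -> x != b :> nat.
  by move=> xS; apply: contraNneq bS => /val_inj <-.
have ab : a < b by have := neb a aS; lia.
have [e1 e1S e1b] := @run_end_before n S a b aS ab neb.
have [|e2 e2S e2c] := @run_end_before n S c n cS (ltn_ord c).
  by move=> x _; rewrite neq_ltn ltn_ord.
by have e12 := card_le1_eqP S1 _ _ e1S e2S; subst; lia.
Qed.

(** A left neighbour of [j] (the set [A]) stops being a run end, and [j] becomes one only if it has
    no right neighbour (the set [B]). So the number of runs grows by at most [1 - #|A| - #|B|]. *)
Lemma run_endsU1 n (S : {set 'I_n}) (j : 'I_n) : j \notin S ->
  #|run_ends (j |: S)| + #|[set k in S | adjacent j k]| <= #|run_ends S| + 1.
Proof.
move=> jS.
pose A := [set k in S | k.+1 == j :> nat].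
pose B := [set k in S | j.+1 == k :> nat].
have AE : A \subset run_ends S.
  apply/subsetP => k; rewrite !inE => /andP[kS /eqP kj]; rewrite kS /=.
  by apply/forall_inP => l lS; rewrite kj; apply: contraNneq jS => /val_inj <-.
have adjAB : #|[set k in S | adjacent j k]| <= #|A| + #|B|.
  apply: leq_trans (leq_card_setU A B); apply/subset_leq_card/subsetP => k.
  by rewrite !inE /adjacent => /andP[-> /orP[] ->]; rewrite ?orbT.
have B1 : #|B| <= 1.
  apply/card_le1_eqP => k l; rewrite !inE => /andP[_ /eqP jk] /andP[_ /eqP jl].
  by apply: val_inj; rewrite /= -jk -jl.
have endU : run_ends (j |: S) \subset
    (run_ends S :\: A) :|: [set k | (k == j) && (B == set0)].
  apply/subsetP => k; rewrite in_set => /andP[kjS /forall_inP kend].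
  have [kj|kj] := eqVneq k j; rewrite !inE.
    rewrite kj eqxx /=; apply/orP; right; apply/eqP/setP => l; rewrite !inE.
    apply/negP => /andP[lS /eqP jl].
    by have := kend l; rewrite !inE lS orbT => /(_ isT); rewrite kj jl eqxx.
  move: kjS; rewrite !inE (negPf kj) /= orbF => kS; rewrite kS /=.
  apply/andP; split.
    by have := kend j (setU11 _ _); rewrite eq_sym.
  by apply/forall_inP => l lS; apply: kend; rewrite inE lS orbT.
have leU : #|run_ends (j |: S)| <=
    #|run_ends S| - #|A| + #|[set k | (k == j) && (B == set0)]|.
  rewrite -cardsDS //.
  exact: leq_trans (subset_leq_card endU) (leq_card_setU _ _).
have leA : #|A| <= #|run_ends S| by apply: subset_leq_card.
have le1 : #|[set k | (k == j) && (B == set0)]| <= 1 - #|B|.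
  have [B0|Bn0] := eqVneq B set0.
    rewrite B0 cards0 subn0 -(cards1 j); apply/subset_leq_card/subsetP => k.
    by rewrite !inE => /andP[].
  by rewrite (eq_card0 (_ : _ =i pred0)) // => k; rewrite !inE andbF.
lia.
Qed.

Lemma convex_ord_interval n (S : {set 'I_n}) (x0 : 'I_n) :
  x0 \in S -> convex_ord S ->
  exists2 a, a + #|S| <= n & forall x : 'I_n, (x \in S) = (a <= x < a + #|S|).
Proof.
move=> x0S cS.
have [a aS amin] := @arg_minnP _ x0 (mem S) val x0S.
have [z zS zmax] := @arg_maxnP _ x0 (mem S) val x0S.
have SE (x : 'I_n) : (x \in S) = (a <= x < z.+1).
  apply/idP/idP => [xS|axz]; last by apply: cS axz.
  by rewrite ltnS; apply/andP; split; [apply: amin | apply: zmax].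
have az : a <= z by apply: amin.
have cardS : #|S| = z.+1 - a.
  rewrite -[RHS]muln1 -sum_nat_const_nat (big_nat_widenl a 0) //.
  rewrite (big_nat_widen 0 z.+1 n) // big_mkord -sum1_card.
  by apply: eq_bigl => x; rewrite SE.
exists a => [|x]; first by rewrite cardS; have := ltn_ord z; lia.
by rewrite SE cardS subnKC //; lia.
Qed.

(** * Runs of a matrix under percolation *)

Lemma row_runs_fill m n (M : 'M[bool]_(m, n)) (i : 'I_m) (j : 'I_n) :
  ~~ M i j ->
  row_runs (fill M (i, j)) + #|[set k in row_ones M i | adjacent j k]|
    <= row_runs M + 1.
Proof.
move=> Mij; rewrite /row_runs (bigD1 i) // [in X in _ <= X](bigD1 i) //=.
have -> : row_ones (fill M (i, j)) i = j |: row_ones M i.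
  apply/setP => k; rewrite !inE mxE xpair_eqE eqxx /=.
  by case: (k == j).
rewrite (eq_bigr (fun l => #|run_ends (row_ones M l)|)) => [|l li]; last first.
  congr #|run_ends _|; apply/setP => k.
  by rewrite !inE mxE xpair_eqE (negPf li).
by rewrite addnAC [leqRHS]addnAC leq_add2r; apply: run_endsU1; rewrite inE.
Qed.

Lemma trmx_fill m n (M : 'M[bool]_(m, n)) (i : 'I_m) (j : 'I_n) :
  (fill M (i, j))^T%R = fill M^T%R (j, i).
Proof. by apply/matrixP => k l; rewrite !mxE !xpair_eqE andbC. Qed.

Lemma card_neighbours m n (M : 'M[bool]_(m, n)) (i : 'I_m) (j : 'I_n) :
  #|[set d in ones M | neighbour (i, j) d]| <=
  #|[set k in row_ones M i | adjacent j k]|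
    + #|[set k in row_ones M^T%R j | adjacent i k]|.
Proof.
set H := [set k in row_ones M i | _]; set V := [set k in row_ones _ j | _].
apply: leq_trans (_ : #|(pair i @: H) :|: (pair^~ j @: V)| <= _); last first.
  by apply: leq_trans (leq_card_setU _ _) (leq_add _ _); apply: leq_imset_card.
apply/subset_leq_card/subsetP => -[k l]; rewrite !inE /neighbour /=.
move=> /andP[Mkl /orP[] /andP[/eqP e adj]]; subst; apply/orP; [left|right].
  by apply: imset_f; rewrite !inE Mkl.
by apply: (imset_f (pair^~ l)); rewrite !inE mxE Mkl.
Qed.

(** If the filled cell has [h] horizontal and [v] vertical neighbours containing one, the row runs
    grow by at most [1 - h] and the column runs by at most [1 - v]. Mutability gives [h + v >= 2],
    so the total does not grow. *)
Lemma perc_sequence_runs m n (M0 : 'M[bool]_(m, n)) Ms :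
  perc_sequence M0 Ms ->
  row_runs (last M0 Ms) + row_runs (last M0 Ms)^T%R
    <= row_runs M0 + row_runs M0^T%R.
Proof.
elim: Ms M0 => [//|M1 Ms IH] M0 /= /andP[/existsP[[i j] /andP[mut /eqP M1E]]].
move=> /IH /leq_trans; apply; rewrite {}M1E trmx_fill.
move: mut; rewrite /mutable inE /= => /andP[Mij nb].
have := leq_trans nb (card_neighbours _ _ M0 i j).
have := @row_runs_fill _ _ M0 i j Mij.
by have := @row_runs_fill _ _ M0^T%R j i; rewrite mxE => /(_ Mij); lia.
Qed.

Lemma perc_sequence_mono m n (M0 : 'M[bool]_(m, n)) Ms i j :
  perc_sequence M0 Ms -> M0 i j -> last M0 Ms i j.
Proof.
elim: Ms M0 => [//|M1 Ms IH] M0 /= /andP[/existsP[c /andP[_ /eqP M1E]] pMs] Mij.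
by apply: IH => //; rewrite M1E mxE Mij; case: ifP.
Qed.

Lemma row_runs_perm n (s : 'S_n) : row_runs (perm_mx s : 'M[bool]_n) <= n.
Proof.
rewrite -[X in _ <= X]card_ord -sum1_card; apply: leq_sum => i _.
rewrite -(cards1 (s i)); apply/subset_leq_card/subsetP => j.
by rewrite !inE !mxE => /andP[]; rewrite eq_sym; case: eqP.
Qed.

(* If [n] nonempty lines have at most [n] runs in total, none has two. *)
Lemma row_runs_convex n (M : 'M[bool]_n) : row_runs M <= n ->
  (forall i, 0 < #|run_ends (row_ones M i)|) ->
  forall i, convex_ord (row_ones M i).
Proof.
move=> le_n gt0 i; apply: run_ends_convex.
have cardn : n = 1 + \sum_(j < n | j != i) 1.
  by rewrite -[LHS]card_ord -sum1_card (bigD1 i).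
rewrite -(leq_add2r (\sum_(j < n | j != i) 1)) -cardn.
apply: leq_trans le_n; rewrite /row_runs [leqRHS](bigD1 i) //= leq_add2l.
exact: leq_sum.
Qed.

Lemma row_runs_ge n (M : 'M[bool]_n) :
  (forall i, 0 < #|run_ends (row_ones M i)|) -> n <= row_runs M.
Proof.
by move=> gt0; rewrite -[X in X <= _]card_ord -sum1_card; apply: leq_sum.
Qed.

(** * Rows of a stable configuration *)

(** Starting from the shared column [j], the ones of row [i] are copied into row [i'] one column at
    a time: a missing one would sit in a corner between two ones and be mutable. *)
Lemma adjacent_row_sub m n (M : 'M[bool]_(m, n)) (i i' : 'I_m) (j : 'I_n) :
  (forall c, ~~ mutable M c) -> convex_ord (row_ones M i) -> adjacent i i' ->
  M i j -> M i' j -> row_ones M i \subset row_ones M i'.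
Proof.
move=> stable cvx ii' Mij Mi'j; apply/subsetP => k; rewrite !inE.
(* With truncated subtraction this sum is the distance between [j] and [k]; the column [k'] below is
   one step closer to [j]. *)
have [d] := ubnP ((j - k) + (k - j)); elim: d k => [//|d IH] k dk Mik.
have [->//|kj] := eqVneq k j.
have [k' kk' [dk' btw]] : exists2 k' : 'I_n, adjacent k k' &
    (j - k') + (k' - j) < d /\ (j <= k' <= k \/ k <= k' <= j).
  have kjn : (k : nat) != j by [].
  have [lt|ge] := ltnP k j.
    have ltn : k.+1 < n by have := ltn_ord j; lia.
    by exists (Ordinal ltn); rewrite /adjacent /=; lia.
  have ltn : k.-1 < n by have := ltn_ord k; lia.
  by exists (Ordinal ltn); rewrite /adjacent /=; lia.
have Mik' : M i k'.
  by case: btw => [/(cvx _ _ _)|/(cvx _ _ _)]; rewrite !inE; apply.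
have Mi'k' := IH k' dk' Mik'.
(* The zero cell [(i', k)] has at most one neighbour containing one, so [(i', k')] and [(i, k)]
   would coincide, giving [i' = i] against [Mik]. *)
apply: contraT => Mi'k; have := stable (i', k).
rewrite /mutable inE /= Mi'k /= -ltnNge ltnS => /card_le1_eqP/(_ (i', k') (i, k)).
rewrite !inE /neighbour /= Mi'k' Mik !eqxx /=.
move: ii' kk'; rewrite /adjacent orbC => -> ->; rewrite orbT.
by move=> /(_ isT isT)[i'i _]; rewrite i'i (negPf Mi'k) in Mik.
Qed.

Lemma rows_sharing_col_eq m n (M : 'M[bool]_(m, n)) :
  (forall c, ~~ mutable M c) -> (forall i, convex_ord (row_ones M i)) ->
  (forall j, convex_ord (row_ones M^T%R j)) ->
  forall i i' j, M i j -> M i' j -> row_ones M i = row_ones M i'.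
Proof.
move=> stable cvxr cvxc i i' j.
wlog le_ii' : i i' / i <= i' => [hw Mi Mi'|].
  by case/orP: (leq_total i i') => h; [|symmetry]; apply: hw.
have [d] := ubnP (i' - i); elim: d i le_ii' => [//|d IH] i le_ii' dlt Mij Mi'j.
have [->//|ne] := eqVneq i i'.
have nen : (i : nat) != i' by [].
have lt : i.+1 < m by have := ltn_ord i'; lia.
pose i1 := Ordinal lt.
(* Convexity of column [j] carries the shared one to the next row, so the rows can be compared one
   step at a time. *)
have Mi1j : M i1 j.
  have := cvxc j i i1 i'; rewrite !inE !mxE; apply => //=; lia.
transitivity (row_ones M i1); last by apply: IH => //=; lia.
apply/eqP; rewrite eqEsubset; apply/andP.
by split; apply: (@adjacent_row_sub _ _ _ _ _ j) => //;
  rewrite /adjacent /= eqxx ?orbT.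
Qed.

(** * The tile of a class of equal rows *)

Definition row_class {m n : nat} (M : 'M[bool]_(m, n)) (S : {set 'I_n}) :
  {set 'I_m} := [set i | row_ones M i == S].

Lemma square_tile_row_class n (M : 'M[bool]_n) (s : 'S_n) (i0 : 'I_n) :
  (forall i, M i (s i)) -> (forall i, convex_ord (row_ones M i)) ->
  (forall j, convex_ord (row_ones M^T%R j)) ->
  (forall i i' j, M i j -> M i' j -> row_ones M i = row_ones M i') ->
  square_tile (setX (row_class M (row_ones M i0)) (row_ones M i0)).
Proof.
move=> Ms cvxr cvxc share; set S := row_ones M i0; set K := row_class M S.
have s0S : s i0 \in S by rewrite inE.
(* The class is a whole column of ones, so column convexity makes it an interval. *)
have KE : K = row_ones M^T%R (s i0).
  apply/setP => i; rewrite !inE mxE; apply/eqP/idP => [SE|Mi].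
    by move: s0S; rewrite -SE inE.
  exact: share Mi (Ms i0).
have cardK : #|K| = #|S|.
  (* [s] maps [K] onto [S]: a column [j] in [S] comes from the row [s^-1 j], which shares column [j]
     with row [i0] and hence lies in [K]. *)
  rewrite -(card_imset K (@perm_inj _ s)); congr #|pred_of_set _|.
  apply/setP => j; apply/imsetP/idP => [[i]|jS].
    by rewrite inE => /eqP <- ->; rewrite inE.
  exists ((s^-1)%g j); last by rewrite permKV.
  rewrite inE; apply/eqP; apply: (share _ _ j); first by rewrite -{2}[j](permKV s).
  by rewrite inE in jS.
have i0K : i0 \in K by rewrite inE.
have cK : convex_ord K by rewrite KE.
have [a an aE] := @convex_ord_interval _ _ _ i0K cK.
have [b bn bE] := @convex_ord_interval _ _ _ s0S (cvxr i0).
exists #|S|; split; try by apply/card_gt0P; exists (s i0).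
exists a, b; split; rewrite -?cardK // ?cardK //.
by apply/setP => -[i j]; rewrite !in_setX aE bE cardK inE.
Qed.

Theorem theorem2p11 (n : nat) (n_gt0 : 0 < n)
    (M0 : 'M[bool]_n) (Ms : seq 'M[bool]_n) :
  is_perm_mx M0 ->
  complete_perc_sequence M0 Ms ->
  let Mr := last M0 Ms in
  exists2 m : nat, 1 <= m <= n &
  exists T : 'I_m -> {set cell n n},
    [/\ forall k, square_tile (T k) /\ unitary Mr (T k),
        forall k l, k != l -> [disjoint T k & T l],
        ones Mr = \bigcup_k T k,
        forall i : 'I_n, exists! k, meets_row (T k) i &
        forall j : 'I_n, exists! k, meets_col (T k) j].
Proof.
move=> /existsP[s /eqP M0E] /andP[perc /forallP stable]; move=> M.
have Ms1 i : M i (s i).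
  by apply: perc_sequence_mono => //; rewrite M0E !mxE eqxx.
have row_gt0 i : 0 < #|run_ends (row_ones M i)|.
  by apply: (@run_ends_gt0 _ _ (s i)); rewrite inE.
have col_gt0 j : 0 < #|run_ends (row_ones M^T%R j)|.
  by apply: (@run_ends_gt0 _ _ ((s^-1)%g j)); rewrite inE mxE -{2}[j](permKV s).
have runs : row_runs M + row_runs M^T%R <= n + n.
  apply: leq_trans (@perc_sequence_runs _ _ _ _ perc) _.
  by rewrite M0E tr_perm_mx leq_add // row_runs_perm.
(* Only the sum is bounded, by [2n]; as both counts are at least [n], each is also at most [n]. *)
have := row_runs_ge _ _ row_gt0; have := row_runs_ge _ _ col_gt0 => geC geR.
have cvxr : forall i, convex_ord (row_ones M i).
  by apply: row_runs_convex => //; lia.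
have cvxc : forall j, convex_ord (row_ones M^T%R j).
  by apply: row_runs_convex => //; lia.
have share := @rows_sharing_col_eq _ _ M stable cvxr cvxc.
(* Tiles are indexed by the distinct row patterns, so there are at most [n] of them; [idx i] is the
   tile met by row [i]. *)
pose P := [set row_ones M i | i in 'I_n].
have rowP i : row_ones M i \in P by apply: imset_f.
pose T (k : 'I_#|P|) := setX (row_class M (enum_val k)) (enum_val k).
have TE k i j : ((i, j) \in T k) = (row_ones M i == enum_val k) && M i j.
  by rewrite in_setX inE; case: eqP => [<-|//]; rewrite inE.
pose idx i := enum_rank_in (rowP i) (row_ones M i).
have idxE i : enum_val (idx i) = row_ones M i by rewrite enum_rankK_in.
exists #|P|.
  apply/andP; split.
    by apply/card_gt0P; exists (row_ones M (Ordinal n_gt0)).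
  by rewrite -[X in _ <= X](card_ord n) leq_imset_card.
exists T; split => [k|k l kl||i|j].
- split; last by apply/subsetP => -[i j]; rewrite TE inE => /andP[].
  have /imsetP[i _ kE] := enum_valP k.
  by rewrite /T kE; apply: (@square_tile_row_class _ _ s).
- apply/pred0P => -[i j] /=; apply/negP => /andP[].
  rewrite !TE => /andP[/eqP ki _] /andP[/eqP li _].
  by move/eqP: kl; apply; apply: enum_val_inj; rewrite -ki.
- apply/setP => -[i j]; rewrite inE /=; apply/idP/bigcupP => [Mij|[k _]].
    by exists (idx i) => //; rewrite TE idxE eqxx.
  by rewrite TE => /andP[].
- exists (idx i); split.
    by apply/existsP; exists (s i); rewrite TE idxE eqxx Ms1.
  move=> k /existsP[j]; rewrite TE => /andP[/eqP ki _].
  by apply: enum_val_inj; rewrite idxE.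
(* Column [j] meets the tile of row [s^-1 j]; any other row with a one in this column has the same
   pattern, hence the same tile. *)
- have Mj : M ((s^-1)%g j) j by rewrite -{2}[j](permKV s).
  exists (idx ((s^-1)%g j)); split.
    by apply/existsP; exists ((s^-1)%g j); rewrite TE idxE eqxx Mj.
  move=> k /existsP[i]; rewrite TE => /andP[/eqP ki Mij].
  by apply: enum_val_inj; rewrite idxE -ki; apply: share Mj Mij.
Qed.
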